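(* Let $G$ be a finite group of order $n$ satisfying $$\psi(G)\geq \frac{3}{5}\,n\,\varphi(n).$$ Then $G$ is solvable and $G''\leq Z(G)$.
   Context: For a finite group $G$, $\psi(G)=\sum_{g\in G} o(g)$ denotes the sum of the orders of all elements of $G$. $\varphi$ is Euler's totient function. $G''=[G',G']$ and $Z(G)$ is the center. *)

(* Defs.v *)
From mathcomp Require Import all_boot all_fingroup all_solvable.
Set Implicit Arguments. Unset Strict Implicit. Unset Printing Implicit Defensive.

Definition psi (gT : finGroupType) (G : {set gT}) : nat := \sum_(g in G) #[g]%g.

(* Main.v *)
Require Import Defs.
From mathcomp Require Import all_boot all_fingroup all_solvable.
From mathcomp Require Import zify.
From mathcomp Require vcharacter.
Set Implicit Arguments. Unset Strict Implicit. Unset Printing Implicit Defensive.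
Import GroupScope.

(** Let [p] be the largest prime divisor of [n]. Averaging yields [x] in [G] with
    [#|G : <[x]>| <= 5/3 * n / totient n <= 5/3 * p < 2 * p]. Sylow's theorem then
    leaves two cases. Either [<[x]>] is a maximal subgroup of [G]; modulo the
    centre it is normal or a Frobenius complement with abelian kernel, and the
    conclusion follows. Or the Sylow [p]-subgroup [P] of [G] is cyclic and normal;
    then [psi G <= c * #|P| * totient #|P| * psi (G / P)] where
    [c = 1 + 1 / (p * (p - 1))], so [G / P] satisfies a slightly weaker form of the
    hypothesis. The product of these losses over all odd primes is small enough
    for the index estimate to survive all the way down to a 2-group with a cyclic
    subgroup of index at most 4. *)

(** * Euler's totient and element orders *)

(** The ratio [n / totient n] is the product of [q / (q - 1)] over the primes [q] dividing [n], and
    the product of [j / (j - 1)] over all [2 <= j <= k] telescopes to [k]. *)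
Lemma leq_mul_totient (k n : nat) :
    (0 < k)%N -> (0 < n)%N -> (forall q, prime q -> (q %| n)%N -> (q <= k)%N) ->
  (n <= k * totient n)%N.
Proof.
elim: k n => // k IHk n _ n_gt0 le_k.
have [-> | n_neq1] := eqVneq n 1%N; first by rewrite muln1.
have k_gt0: (0 < k)%N.
  have n_gt1: (1 < n)%N by lia.
  have := le_k _ (pdiv_prime n_gt1) (pdiv_dvd n).
  by have := prime_gt1 (pdiv_prime n_gt1); lia.
have [/andP[pr_k dv_k] | notk] := boolP (prime k.+1 && (k.+1 %| n)%N); last first.
  suffices: (n <= k * totient n)%N by rewrite mulSn; lia.
  apply: IHk => // q pr_q dv_q; have:= le_k q pr_q dv_q.
  rewrite leq_eqVlt => /predU1P[eq_q | //].
  by rewrite -eq_q pr_q dv_q in notk.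
set p := k.+1 in pr_k dv_k.
have [m cop def_n] := pfactor_coprime pr_k n_gt0.
set a := logn p n in def_n.
have a_gt0: (0 < a)%N by rewrite logn_gt0 mem_primes pr_k n_gt0.
have m_gt0: (0 < m)%N by move: n_gt0; rewrite def_n muln_gt0 => /andP[].
have le_m: (m <= k * totient m)%N.
  apply: IHk => // q pr_q dv_q.
  have: (q <= p)%N by apply: le_k => //; rewrite def_n dvdn_mulr.
  rewrite leq_eqVlt => /predU1P[eq_q | //].
  by move: cop; rewrite prime_coprime // -eq_q dv_q.
rewrite def_n totient_coprime ?coprimeXr 1?coprime_sym // totient_pfactor //.
rewrite -[in X in (X <= _)%N](prednK a_gt0) expnS /=.
by rewrite mulnCA -/p leq_mul2l mulnA [(_ * k)%N]mulnC leq_mul2r le_m !orbT.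
Qed.

Lemma psi_max_order (gT : finGroupType) (G : {group gT}) :
  exists2 x, x \in G & (psi G <= #|G| * #[x])%N.
Proof.
case: (@arg_maxnP _ 1 (mem G) (fun x => #[x]) (group1 G)) => x Gx max_x.
by exists x; rewrite // /psi -sum_nat_const leq_sum.
Qed.

(** * Order sums and normal cyclic Sylow subgroups *)

Section NormalCyclicSylow.

Variables (gT : finGroupType) (p a : nat) (P : {group gT}).
Hypotheses (p_pr : prime p) (oP : #|P| = (p ^ a.+1)%N).

Let p_gt1 : (1 < p)%N := prime_gt1 p_pr.

Lemma card_proper_pgroup (D : {group gT}) :
  D \subset P -> D :!=: P -> (#|D| <= p ^ a)%N.
Proof.
move=> sDP neqDP; have: (#|D| %| p ^ a.+1)%N by rewrite -oP cardSg.
case/dvdn_pfactor=> // b le_b oD; rewrite oD leq_exp2l // -ltnS ltn_neqAle le_b andbT.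
by apply: contra neqDP => /eqP eq_b; rewrite eqEcard sDP oP oD eq_b /=.
Qed.

(** Generators have order [p ^ a.+1], the other [p ^ a] elements order at most [p ^ a]. The bound is
    [1 + 1 / (p * (p - 1))] times [#|P| * totient #|P|]. *)
Lemma psi_cyclic_pgroup :
  cyclic P -> (psi P <= p ^ a * p ^ a * (p * p.-1).+1)%N.
Proof.
case/cyclicP=> x defP; pose gen : pred gT := fun y => generator <[x]> y.
have phi: \sum_(y in P | gen y) 1%N = (p.-1 * p ^ a)%N.
  rewrite sum1dep_card -(totient_pfactor p_pr (ltn0Sn a)) -oP defP.
  rewrite -/(#[x]) totient_gen; apply: eq_card => y; rewrite !inE andb_idl //.
  by rewrite /gen /generator => /eqP->; apply: cycle_id.
have ngen: \sum_(y in P | ~~ gen y) 1%N = (p ^ a)%N.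
  apply: (@addnI (p.-1 * p ^ a)%N); rewrite -phi -[LHS](bigID gen) /= sum1_card oP.
  by rewrite phi expnS; nia.
rewrite /psi (bigID gen) /=.
apply: (@leq_trans (\sum_(y in P | gen y) (p ^ a.+1) + \sum_(y in P | ~~ gen y) p ^ a)%N).
  apply: leq_add; apply: leq_sum => y /andP[Py gen_y].
    by rewrite -oP dvdn_leq // order_dvdG.
  apply: card_proper_pgroup; first by rewrite cycle_subG.
  by rewrite eq_sym defP.
have sumE (F : pred gT) c : \sum_(y in P | F y) c = (c * \sum_(y in P | F y) 1)%N.
  by rewrite big_distrr /=; apply: eq_bigr => y _; rewrite muln1.
by rewrite [X in (X + _)%N]sumE [X in (_ + X)%N]sumE phi ngen expnS; nia.
Qed.

(* For [g] in a coset of order [m] and [u] in [P], [#[g * u]] is [m] times the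
   order of [(g * u) ^+ m]. The latter element runs over [P] as [u] does if [g]
   centralises [P], and stays in the proper subgroup ['C_P[g]] otherwise. *)
Lemma psi_cyclic_Sylow_quotient (G : {group gT}) :
    cyclic P -> P <| G -> coprime #|P| #|G / P| ->
  (psi G <= p ^ a * p ^ a * (p * p.-1).+1 * psi (G / P))%N.
Proof.
move=> cycP nsPG coPG; have [sPG nPG] := andP nsPG.
have cPP := cyclic_abelian cycP.
rewrite /psi (partition_big (coset P) (mem (G / P))) /=; last first.
  by move=> g Gg; apply: mem_quotient.
rewrite big_distrr /=; apply: leq_sum => _ /morphimP[g Ng Gg ->].
set m := #[_]; set B := (_ * (p * _).+1)%N.
have sum_coset (F : gT -> nat) :
  \sum_(h in G | coset P h == coset P g) F h = \sum_(u in P) F (g * u)%g.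
  rewrite (reindex_inj (mulgI g)); apply: eq_bigl => u.
  rewrite groupMl //; apply/andP/idP=> [[Gu] | Pu].
    rewrite morphM ?(subsetP nPG u Gu) // -[X in _ == X]mulg1 (inj_eq (mulgI _)).
    by move/eqP/coset_idr; apply; apply: (subsetP nPG).
  have Gu := subsetP sPG u Pu.
  by rewrite Gu morphM ?(subsetP nPG u Gu) // [X in _ * X]coset_id // mulg1.
rewrite sum_coset mulnC.
have NP u : u \in P -> u \in 'N(P) by move/(subsetP (normG P)).
have cosetM u : u \in P -> coset P (g * u) = coset P g.
  exact: coset_kerr.
have mP u : u \in P -> (g * u) ^+ m \in P.
  move=> Pu; have Ngu: g * u \in 'N(P) by apply: groupM => //; apply: NP.
  apply: coset_idr; first exact: groupX.
  by rewrite morphX //= cosetM //; apply: expg_order.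
have om u : u \in P -> #[g * u] = (m * #[(g * u) ^+ m])%N.
  move=> Pu; have dv_m: (m %| #[g * u])%N.
    by rewrite /m /= -(cosetM u Pu) morph_order //; apply: groupM => //; apply: NP.
  by rewrite orderXdiv // mulnC divnK.
rewrite (eq_bigr _ om) -big_distrr leq_mul2l; apply/orP; right.
have [cgP | not_cgP] := boolP (P \subset 'C[g]).
  apply: leq_trans (psi_cyclic_pgroup cycP).
  have coPm: coprime #|P| m by apply: coprime_dvdr coPG; rewrite order_dvdG ?mem_quotient.
  pose f u := (g * u) ^+ m.
  have fE u : u \in P -> f u = g ^+ m * u ^+ m.
    by move=> Pu; rewrite /f expgMn //; apply/commute_sym/cent1P/(subsetP cgP).
  have inj_f: {in P &, injective f}.
    move=> u v Pu Pv; rewrite !fE // => /mulgI eq_uv.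
    by rewrite -(expgK coPm Pu) -(expgK coPm Pv) eq_uv.
  have imf: f @: P = P.
    apply/eqP; rewrite eqEcard card_in_imset // leqnn andbT.
    by apply/subsetP=> _ /imsetP[u Pu ->]; apply: mP.
  by rewrite /psi -[in X in (_ <= X)%N]imf big_imset.
(* Here the crude bound [p ^ a.+1 * p ^ a] is enough, since [p <= p * (p - 1) + 1]. *)
apply: (@leq_trans (\sum_(u in P) p ^ a)); last first.
  rewrite sum_nat_const oP expnS /B -[leqLHS]mulnA [leqLHS]mulnC leq_mul2l.
  by case: (p) p_gt1 => [|[|q]] // _; rewrite orbC mulnS leqW ?leq_addr.
apply: leq_sum => u Pu; apply: leq_trans (_ : #|'C_P[g]| <= _)%N; last first.
  apply: card_proper_pgroup; first exact: subsetIl.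
  by apply: contra not_cgP => /eqP/setIidPl.
apply: dvdn_leq => //; apply: order_dvdG; rewrite inE mP //=.
(* Commuting with both [u] and [g * u] puts the power in the centraliser of [g]. *)
have cux: commute ((g * u) ^+ m) u by apply: (centsP cPP); rewrite ?mP.
have: commute ((g * u) ^+ m) (g * u) by apply/commute_sym/commuteX.
by move/commuteM/(_ (commuteV cux)); rewrite mulgK => cgu; apply/cent1P.
Qed.

End NormalCyclicSylow.

(** * Maximal abelian subgroups *)

Definition der2_central (gT : finGroupType) (G : {group gT}) :=
  solvable G /\ G^`(2) \subset 'Z(G).

Lemma solvable_der2_central (gT : finGroupType) (G : {group gT}) :
  G^`(2) \subset 'Z(G) -> der2_central G.
Proof.
move=> sG2Z; split=> //; apply/derivedP; exists 3; apply/commG1P.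
exact: abelianS sG2Z (center_abelian G).
Qed.

Lemma der2_central_metabelian (gT : finGroupType) (G : {group gT}) :
  abelian G^`(1) -> der2_central G.
Proof.
move=> abG'; apply: solvable_der2_central.
by rewrite (_ : G^`(2) = 1) ?sub1G //; apply/commG1P.
Qed.

(** Maximality of [A] leaves no [A]-invariant subgroup strictly between [1] and [K]. Applied to an
    [A]-invariant Sylow subgroup this makes [K] a [p]-group; applied to the derived subgroup of [K]
    it makes [K] abelian. *)
Lemma Frobenius_maximal_abelian_kernel (gT : finGroupType) (G K A : {group gT}) :
  solvable A -> maximal A G -> [Frobenius G = K ><| A] -> abelian K.
Proof.
move=> solA maxA frobG; have [defG ntK _ _ _] := Frobenius_context frobG.
have [_ mulKA nKA tiKA] := sdprodP defG; have [sKG sAG] := mulG_sub mulKA.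
have coKA := Frobenius_coprime frobG.
have [_ topA] := maxgroupP maxA.
have invA (L : {group gT}) : L \subset K -> A \subset 'N(L) -> L :=: 1 \/ L :=: K.
  move=> sLK nLA; have sLAG: L <*> A \subset G.
    by rewrite join_subG sAG (subset_trans sLK).
  have [eqLAG | neqLAG] := eqVneq (L <*> A)%g G.
    right; apply/eqP; rewrite eqEsubset sLK -(setIidPl sKG) -eqLAG norm_joinEr //.
    by rewrite setIC -group_modl // [A :&: K]setIC tiKA mulg1 /=.
  left; apply/trivgP; rewrite -tiKA subsetI sLK.
  by rewrite -(topA (L <*> A)%G) ?joing_subl ?joing_subr // properEneq neqLAG.
have [p p_pr p_dv] : exists2 p, prime p & (p %| #|K|)%N.
  exists (pdiv #|K|); last exact: pdiv_dvd.
  by rewrite pdiv_prime // cardG_gt1.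
have [P sylP nPA] := sol_coprime_Sylow_exists p solA nKA coKA.
have [P1 | defP] := invA P (pHall_sub sylP) nPA.
  have := p_part_eq1 p #|K|.
  by rewrite -(card_Hall sylP) P1 cards1 mem_primes p_pr p_dv cardG_gt0.
have nilK: nilpotent K by rewrite -defP; apply: pgroup_nil (pHall_pgroup sylP).
have [K'1 | K'K] := invA K^`(1)%G (der_sub 1 K) (gFnorm_trans _ nKA).
  exact/commG1P.
by have := sol_der1_proper (nilpotent_sol nilK) (subxx K) ntK; rewrite /= K'K properxx.
Qed.

(* If [A] is not normal then [A] and [A :^ g] generate [G] for [g] outside [A],
   so [A :&: A :^ g] is central and [A / 'Z(G)] is a Frobenius complement. *)
Lemma maximal_abelian_der2_central (gT : finGroupType) (G A : {group gT}) :
  maximal A G -> abelian A -> der2_central G.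
Proof.
move=> maxA cAA; have [/andP[sAG nsGA] topA] := maxgroupP maxA.
have [nAG | not_nAG] := boolP (G \subset 'N(A)).
  apply: der2_central_metabelian; apply: abelianS cAA; apply: der1_min => //.
  have [x Gx notAx] := subsetPn nsGA.
  have sXG: <[x]> \subset G by rewrite cycle_subG.
  have <-: A * <[x]> = G by apply: mulg_normal_maximal; rewrite ?cycle_subG // /normal sAG.
  by rewrite quotientMidl quotient_abelian ?cycle_abelian.
have genA (g : gT) : g \in G -> g \notin A -> A :&: A :^ g \subset 'Z(G).
  move=> Gg notAg; have sAgG: A :^ g \subset G by rewrite -(conjGid Gg) conjSg.
  rewrite subsetI subIset ?sAG //=.
  suffices defG: A <*> A :^ g = G.
    rewrite -defG centY subsetI subIset ?[A \subset _]cAA //=.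
    by rewrite subIset // orbC -/(abelian _) abelianJ cAA.
  apply/eqP; apply: contraR not_nAG => neqG; have defN: 'N_G(A) = G.
    have eqA: A <*> A :^ g = A.
      by apply: topA; rewrite ?joing_subl // properEneq neqG join_subG sAG.
    have nAg: g \in 'N_G(A).
      by rewrite inE Gg inE -{2}eqA joing_subr.
    apply/eqP/contraT=> neqN; case/negP: notAg.
    by rewrite -(topA 'N_G(A)%G) ?properEneq ?neqN ?subsetIl // subsetI sAG normG.
  by rewrite -defN subsetIr.
(* A centre outside [A] would generate [G] together with [A], making [A] normal. *)
have [sZA | not_sZA] := boolP ('Z(G) \subset A); last first.
  have defG: A <*> 'Z(G) = G.
    apply/eqP; apply: contraR not_sZA => neqG.
    have <-: A <*> 'Z(G) = A; last exact: joing_subr.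
    by apply: topA; rewrite ?joing_subl // properEneq neqG join_subG sAG subsetIl.
  case/negP: not_nAG; rewrite -{1}defG join_subG normG /=.
  by rewrite (subset_trans _ (cent_sub A)) // subIset // orbC centS.
pose Z := 'Z(G); have nsZG: Z <| G := center_normal G.
have nsZA: Z <| A := normalS sZA sAG nsZG.
have nZG := normal_norm nsZG; have nZA := normal_norm nsZA.
have neqZA: A / Z != 1.
  rewrite -subG1 quotient_sub1 //; apply: contra not_nAG => sAZ.
  by rewrite (subset_trans _ (cent_sub A)) // centsC (subset_trans sAZ) ?subsetIr.
have maxAZ: maximal (A / Z) (G / Z) by rewrite quotient_maximal.
have frobC: [Frobenius (G / Z) with complement (A / Z)].
  apply/andP; split; first exact: proper_neq (maxgroupp maxAZ).
  apply/normedTI_memJ_P; split; first by rewrite setD_eq0 subG1.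
    exact: quotientS.
  move=> b _ /setD1P[ntb Ab] /morphimP[g Ng Gg ->].
  case/morphimP: Ab ntb => a Na Aa -> nta {b}.
  have notZa: a \notin Z by apply: contra nta => Za; apply/eqP/coset_id.
  have memA b : b \in G -> (coset Z b \in A / Z) = (b \in A).
    move=> Gb; apply/idP/idP=> [Ab | ]; last exact: mem_quotient.
    by rewrite -(quotientGK nsZA) inE (subsetP nZG) //= inE.
  have Ga := subsetP sAG a Aa; have Gag: a ^ g \in G by rewrite groupJ.
  have neq1: coset Z a ^ coset Z g != 1 by rewrite conjg_eq1.
  rewrite 2!inE neq1 -[_ ^ _]morphJ //= !memA //.
  apply/idP/idP=> [Aag | Ag]; last by rewrite memJ_norm // (subsetP (normG A)).
  apply: contraR notZa => notAg; rewrite -(memJ_norm _ (subsetP nZG g Gg)).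
  by rewrite (subsetP (genA g Gg notAg)) // inE Aag memJ_conjg.
(* Frobenius's theorem, from character theory, provides the normal complement. *)
have [K frobG] := vcharacter.Frobenius_kernel_exists frobC.
have cKK: abelian K.
  apply: Frobenius_maximal_abelian_kernel maxAZ frobG.
  by rewrite abelian_sol ?quotient_abelian.
have [/sdprodP[_ mulKA nKA _] _ _ _ _] := Frobenius_context frobG.
apply: solvable_der2_central; rewrite -/Z -quotient_sub1 ?quotient_der //; last first.
  exact: gFsub_trans.
suffices sG'K: (G / Z)^`(1) \subset K.
  by apply/trivgP/commG1P; apply: abelianS cKK.
apply: der1_min; rewrite -mulKA ?mul_subG ?normG // quotientMidl.
by rewrite !quotient_abelian.
Qed.

(** * Cyclic subgroups of index below [2 * p] *)

Lemma modn_eq1_lt2p (i p : nat) :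
  (i %% p = 1)%N -> (i < 2 * p)%N -> i = 1%N \/ i = p.+1.
Proof.
move=> mod_i; rewrite (divn_eq i p) mod_i.
case: (i %/ p)%N => [|[|c]] lt_i; [by left | by right; rewrite mul1n addn1 |].
by move: lt_i; rewrite !mulSn mul0n; lia.
Qed.

Lemma dvdn_succ_lt2p (i p : nat) :
  (0 < i)%N -> (p.+1 %| i)%N -> (i < 2 * p)%N -> i = p.+1.
Proof.
move=> i_gt0 /dvdnP[c def_i]; move: i_gt0; rewrite {}def_i.
by case: c => [|[|c]]; rewrite ?mul1n // !mulSn; lia.
Qed.

(* When [p] divides [#|G : A|] that index equals [p]; otherwise [A] contains a
   Sylow [p]-subgroup [P], and [#|G : 'N_G(P)|] is either [1] or [p + 1]. *)
Lemma cyclic_index_lt2p (gT : finGroupType) (p : nat) (G A : {group gT}) :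
    prime p -> A \subset G -> cyclic A -> (#|G : A| < 2 * p)%N ->
  maximal A G \/
    exists P : {group gT}, [/\ p.-Sylow(G) P, cyclic P & P <| G].
Proof.
move=> p_pr sAG cycA lt_iA; have p_gt1 := prime_gt1 p_pr.
have cAA := cyclic_abelian cycA.
have iA_gt0 : (0 < #|G : A|)%N by [].
have [p_dv | p_ndv] := boolP (p %| #|G : A|)%N.
  left; apply: p_index_maximal => //; suffices -> : #|G : A| = p by [].
  case/dvdnP: p_dv => c def_i; move: lt_iA iA_gt0; rewrite def_i ltn_mul2r.
  by case: c {def_i} => [|[|c]] //; rewrite ?mul1n // andbC.
have p'iA: p^'.-nat #|G : A| by rewrite p'natE.
have [P sylP] := Sylow_exists p A; have [sPA _] := andP sylP.
have sPG := subset_trans sPA sAG.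
have sylPG : p.-Sylow(G) P.
  rewrite pHallE sPG (card_Hall sylP) -(Lagrange sAG) partnM //.
  by rewrite [X in (_ * X)%N](part_p'nat p'iA) muln1 eqxx.
have cycP := cyclicS sPA cycA.
have sAN : A \subset 'N(P) by rewrite sub_abelian_norm.
have Sylow_index (M : {group gT}) : A \subset M -> M \subset G ->
  #|M : 'N_M(P)| = 1%N \/ #|M : 'N_M(P)| = p.+1.
- move=> sAM sMG; have sylPM := pHall_subl (subset_trans sPA sAM) sMG sylPG.
  have lt_i : (#|M : 'N_M(P)| < 2 * p)%N.
    apply: leq_ltn_trans lt_iA; apply: dvdn_leq => //.
    apply: dvdn_trans (indexSg sAM sMG).
    by apply: indexgS; rewrite subsetI sAM.
  apply: modn_eq1_lt2p lt_i.
  by have := card_Syl_mod M p_pr; rewrite (card_Syl sylPM).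
have [iN | iN] := Sylow_index G sAG (subxx G).
  right; exists P; split=> //; rewrite /normal sPG.
  by move/eqP: iN; rewrite indexg_eq1 subsetI subxx.
have iA : #|G : A| = p.+1.
  by apply: dvdn_succ_lt2p => //; rewrite -iN; apply: indexgS; rewrite subsetI sAG.
have defN : 'N_G(P) = A.
  apply/eqP; rewrite eq_sym eqEcard subsetI sAG sAN /=.
  by rewrite -(@leq_pmul2r p.+1) // -{1}iN -iA !Lagrange ?subsetIl.
(* A proper subgroup [M] above [A] has ['N_M(P) = A], so the Sylow count in [M] makes [#|M : A|]
   either [1] or [p + 1 = #|G : A|]; the latter would give [M = G]. *)
left; apply/maxgroupP; split=> [|M /properP[sMG [g Gg notMg]] sAM].
  by rewrite properE sAG -indexg_eq1 iA eqSS -lt0n ltnW.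
have defNM : 'N_M(P) = A.
  by apply/eqP; rewrite eqEsubset -{1}defN setSI //= subsetI sAM.
have [iNM | iNM] := Sylow_index M sAM sMG.
  by apply/eqP; rewrite eqEsubset sAM andbT -indexg_eq1 -defNM iNM.
have iGM : #|G : M| = 1%N.
  by apply/eqP; rewrite -(@eqn_pmul2r p.+1) // -{1}iNM defNM Lagrange_index // iA mul1n.
by case/negP: notMg; rewrite (subsetP _ g Gg) // -indexg_eq1 iGM.
Qed.

(** * Lifting the conclusion from a quotient, and 2-groups *)

(** Conjugation maps [G] into [Aut P], which is abelian for cyclic [P], so commutators act
    trivially. *)
Lemma der1_cent_cyclic (gT : finGroupType) (G P : {group gT}) :
  cyclic P -> G \subset 'N(P) -> G^`(1) \subset 'C(P).
Proof.
move=> cycP nPG; rewrite -ker_conj_aut ker_trivg_morphim gFsub_trans //.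
rewrite morphim_der //; apply/trivgP/commG1P.
exact: abelianS (Aut_conj_aut _ _) (Aut_cyclic_abelian cycP).
Qed.

(** Let [H] be a Schur-Zassenhaus complement of [P]. As [H'] centralises [P], the inclusion
    [G' <= P H'] gives [G'' <= H'']. Now [[H'', H]] lies in both [P] and [H], so [H''] centralises
    [H]; and [G'] centralises [P]. Hence [G''] centralises [P H = G]. *)
Lemma der2_central_quotient (gT : finGroupType) (G P : {group gT}) :
  Hall G P -> cyclic P -> P <| G -> der2_central (G / P) -> der2_central G.
Proof.
move=> hallP cycP nsPG [solGP sG2Z]; have [sPG nPG] := andP nsPG.
have cPP := cyclic_abelian cycP.
split; first by rewrite (series_sol nsPG) abelian_sol.
have [H /complP[tiPH defG]] := splitsP (SchurZassenhaus_split hallP nsPG).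
have sHG: H \subset G by rewrite -defG mulG_subr.
have nPH := subset_trans sHG nPG.
have sG'C := der1_cent_cyclic cycP nPG.
have defGP: H / P = G / P by rewrite -defG quotientMidl.
have cH''H: H^`(2) \subset 'C(H).
  have: [~: H^`(2), H] \subset P.
    rewrite -quotient_cents2 ?gFsub_trans // quotient_der // defGP.
    by rewrite (subset_trans sG2Z) ?subsetIr.
  move=> sHP; apply/commG1P/trivgP; rewrite -tiPH subsetI sHP.
  by rewrite commg_subr gFsub_trans ?normG.
have cH'P: H^`(1) \subset 'C(P) by apply: subset_trans sG'C; apply: dergS.
have defK: P \* H^`(1) = P <*> H^`(1).
  by rewrite cprodEY // centsC.
have sG'K: G^`(1) \subset P <*> H^`(1).
  rewrite -(quotientSGK _ (joing_subl _ _)) ?gFsub_trans //.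
  rewrite quotient_der // -defGP -quotient_der // quotientS ?joing_subr //.
have sG2H2: G^`(2) \subset H^`(2).
  apply: subset_trans (dergS 1 sG'K) _.
  rewrite -(der_cprod 1 defK).
  by rewrite (_ : P^`(1) = 1) ?cprod1g; last exact/commG1P.
have cG2P : G^`(2) \subset 'C(P) := subset_trans (der_sub 1 _) sG'C.
by rewrite subsetI der_sub -[X in 'C(X)]defG centM subsetI cG2P (subset_trans sG2H2).
Qed.

(* If [A] is not normal and [M] is a maximal subgroup of [G] above [A], then
   [A :&: A :^ g] lies in ['Z(M)], so [#|M : 'Z(M)| <= 4]. *)
Lemma two_group_abelian_index4 (gT : finGroupType) (G A : {group gT}) :
    2.-group G -> A \subset G -> abelian A -> (#|G : A| <= 4)%N ->
  abelian G^`(1).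
Proof.
move=> pG sAG cAA le_i.
have [nsAG | not_nsAG] := boolP (G \subset 'N(A)).
  apply: abelianS cAA; apply: der1_min => //.
  have pGA : 2.-group (G / A) by rewrite quotient_pgroup.
  apply: (p2group_abelian pGA).
  have [n oGA] := p_natP pGA; rewrite oGA pfactorK //.
  by move: le_i; rewrite -card_quotient // oGA -(leq_exp2l n 2 (ltnSn 1)).
have [M maxM sAM] : exists2 M : {group gT}, maximal M G & A \subset M.
  have [eqAG | //] := maximal_exists sAG.
  by rewrite -eqAG normG in not_nsAG.
have iGM := p_maximal_index pG maxM; have nsMG := p_maximal_normal pG maxM.
have [sMG nMG] := andP nsMG.
have iMA : (#|M : A| <= 2)%N.
  by rewrite -(@leq_pmul2l 2) // -{1}iGM Lagrange_index.
have neqAM : A :!=: M by apply: contraNneq not_nsAG => ->.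
have maxA : maximal A M.
  apply: p_index_maximal => //; suffices -> : #|M : A| = 2 by [].
  have neq1 : (#|M : A| != 1)%N.
    by rewrite indexg_eq1; apply: contra neqAM => sMA; rewrite eqEsubset sAM.
  by apply/eqP; rewrite eqn_leq iMA ltn_neqAle eq_sym neq1 indexg_gt0.
have [g Gg not_nAg] := subsetPn not_nsAG.
have sAgM : A :^ g \subset M by rewrite -(normsP nMG g Gg) conjSg.
pose D := (A :&: A :^ g)%G.
have defM : A <*> A :^ g = M.
  have [_ topA] := maxgroupP maxA; apply/eqP; apply: contraR not_nAg => neqM.
  have defA : A <*> A :^ g = A.
    by apply: topA; rewrite ?joing_subl // properEneq neqM join_subG sAM.
  by rewrite inE -{2}defA joing_subr.
have sDZ : D \subset 'Z(M).
  rewrite subsetI subIset ?sAM //= -defM centY subsetI subIset ?[A \subset _]cAA //=.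
  by rewrite subIset // orbC -/(abelian _) abelianJ cAA.
have iMZ : (#|M : 'Z(M)| <= 4)%N.
  apply: leq_trans (dvdn_leq _ (indexgS M sDZ)) _ => //.
  have sDM : D \subset M by rewrite subIset ?sAM.
  have le_AAg : (#|A| * #|A| <= #|M| * #|D|)%N.
    have := mul_cardG A (A :^ g); rewrite cardJg => ->.
    by rewrite leq_mul2r subset_leq_card ?orbT // mul_subG.
  have le_MA : (#|M| <= #|A| * 2)%N by rewrite -(Lagrange sAM) leq_mul2l iMA orbT.
  have le_AD : (#|A| <= 2 * #|D|)%N.
    rewrite -(leq_pmul2l (cardG_gt0 A)) mulnA.
    by apply: leq_trans le_AAg _; rewrite leq_mul2r le_MA orbT.
  rewrite -(leq_pmul2l (cardG_gt0 D)) Lagrange //.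
  by clear -le_MA le_AD; lia.
have nZG : G \subset 'N('Z(M)) by rewrite gFnorm_trans.
have sG'M : G^`(1) \subset M
  by apply: der1_min; rewrite // cyclic_abelian ?prime_cyclic ?card_quotient ?iGM.
have pGZ : 2.-group (G / 'Z(M)) by rewrite quotient_pgroup.
have cMZ : (#|M / 'Z(M)| <= 4)%N by rewrite card_quotient ?gFnorm.
have cycG'Z : cyclic (G^`(1) / 'Z(M)).
  have sG'ZM := quotientS 'Z(M) sG'M.
  (* If [G'] fills [M] modulo ['Z(M)], the nilpotent group [G / 'Z(M)] has abelianisation of order
     2, hence is cyclic. Otherwise the image of [G'] has order at most 2. *)
  have [eqG'M | neqG'M] := eqVneq (G^`(1) / 'Z(M)) (M / 'Z(M)).
    apply: cyclicS (quotientS _ (der_sub 1 G)) _.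
    apply: cyclic_nilpotent_quo_der1_cyclic (pgroup_nil pGZ) _.
    rewrite -quotient_der // eqG'M prime_cyclic // card_quotient ?quotient_norms //.
    by rewrite index_quotient_eq ?iGM // subIset // center_sub orbT.
  have [-> | neq1] := eqVneq (G^`(1) / 'Z(M)) 1; first exact: cyclic1.
  apply: prime_cyclic; suffices -> : #|G^`(1) / 'Z(M)| = 2 by [].
  apply/eqP; rewrite eqn_leq cardG_gt1 neq1 andbT.
  have iM_gt1 : (1 < #|M / 'Z(M) : G^`(1) / 'Z(M)|)%N.
    by rewrite indexg_gt1 proper_subn // properEneq neqG'M.
  rewrite -(@leq_pmul2r 2) //; apply: leq_trans cMZ.
  by rewrite -(Lagrange sG'ZM) leq_mul2l iM_gt1 orbT.
(* Since [G' <= M], the intersection is central in [G'], with cyclic quotient. *)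
apply: (@cyclic_factor_abelian _ (G^`(1) :&: 'Z(M))).
  by rewrite subsetI subsetIl /= subIset // orbC subIset // orbC centS.
have isoG' := second_isog (subset_trans (der_sub 1 G) nZG).
by rewrite /= setIC (isog_cyclic isoG').
Qed.

(** * Descent over the primes *)

(** Some [x] has at least the average order, hence at least [c / d * totient #|G|]; then
    [#|G| <= k * totient #|G|] bounds its index. *)
Lemma index_cycle_psi_bound (gT : finGroupType) (G : {group gT}) (c d k : nat) :
    (0 < k)%N -> (forall q, prime q -> (q %| #|G|)%N -> (q <= k)%N) ->
    (c * (#|G| * totient #|G|) <= d * psi G)%N ->
  exists2 x, x \in G & (c * #|G : <[x]>| <= d * k)%N.
Proof.
move=> k_gt0 le_k le_psi; have [x Gx le_x] := psi_max_order G; exists x => //.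
have le_phi := leq_mul_totient k_gt0 (cardG_gt0 G) le_k.
have le_ord : (c * totient #|G| <= d * #[x])%N.
  rewrite -(leq_pmul2l (cardG_gt0 G)) mulnCA; apply: leq_trans le_psi _.
  by rewrite [leqRHS]mulnCA leq_mul2l le_x orbT.
rewrite -(leq_pmul2l (order_gt0 x)) mulnCA Lagrange ?cycle_subG //.
apply: leq_trans (_ : c * (k * totient #|G|) <= _)%N.
  by rewrite leq_mul2l le_phi orbT.
by have := leq_mul (leqnn k) le_ord; lia.
Qed.

Lemma leq_ratio_trans (a b c d u v : nat) :
  (0 < a)%N -> (a * u <= b * v)%N -> (b * c <= d * a)%N -> (c * u <= d * v)%N.
Proof.
move=> a_gt0 le_uv le_bd; rewrite -(leq_pmul2l a_gt0) mulnCA.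
apply: leq_trans (leq_mul (leqnn c) le_uv) _.
by rewrite !mulnA leq_mul2r mulnC [(a * d)%N]mulnC le_bd orbT.
Qed.

(* The weight [(8 * k + 7) / (8 * k + 5)] exceeds the product of
   [1 + 1 / (p * (p - 1))] over the odd [p >= 2 * k + 3], which bounds the loss
   incurred when normal cyclic Sylow subgroups are factored out. *)
Lemma psi_bound_der2_central (k : nat) (gT : finGroupType) (G : {group gT}) :
    (forall q, prime q -> (q %| #|G|)%N -> (q <= k.+1.*2)%N) ->
    (3 * (8 * k + 5) * (#|G| * totient #|G|) <= 5 * (8 * k + 7) * psi G)%N ->
  der2_central G.
Proof.
elim: k gT G => [|k IHk] gT G le_q le_psi.
  (* Only the prime 2 can occur here, and [15 * i <= 70] forces index at most 4. *)
  have [x Gx le_i] := index_cycle_psi_bound (isT : 0 < 2)%N le_q le_psi.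
  apply: der2_central_metabelian.
  apply: (@two_group_abelian_index4 _ _ <[x]>); rewrite ?cycle_subG ?cycle_abelian //.
    apply/pgroupP=> q q_pr q_dv; have := le_q q q_pr q_dv.
    by have := prime_gt1 q_pr; rewrite inE /= eqn_leq => -> ->.
  by move: le_i; move: #|_ : _| => i; lia.
(* The prime bound is now [2 * k + 4], even and above 2, so [p] is the largest candidate for a prime
   divisor. *)
set p := k.*2.+3.
have [/andP[p_pr p_dv] | not_p] := boolP (prime p && (p %| #|G|)%N); last first.
  apply: IHk => [q q_pr q_dv|].
    have := le_q q q_pr q_dv; have neq_qp : q <> p.
      by move=> eq_qp; rewrite -eq_qp q_pr q_dv in not_p.
    have neq_q4 : q <> k.*2.+4.
      move=> eq_q; have := even_prime q_pr; rewrite eq_q /= !negbK odd_double.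
      by case.
    by move: neq_qp neq_q4; rewrite /p !doubleS; clear; lia.
  by apply: leq_ratio_trans le_psi _; clear; lia.
have le_qp q : prime q -> (q %| #|G|)%N -> (q <= p)%N.
  move=> q_pr q_dv; have := le_q q q_pr q_dv; have neq_q4 : q <> k.*2.+4.
    move=> eq_q; have := even_prime q_pr; rewrite eq_q /= !negbK odd_double.
    by case.
  by move: neq_q4; rewrite /p !doubleS; clear; lia.
have [x Gx le_i] := index_cycle_psi_bound (isT : 0 < p)%N le_qp le_psi.
(* Strictness comes from [5 * (8 * k + 15) < 6 * (8 * k + 13)]. *)
have lt_i : (#|G : <[x]>| < 2 * p)%N.
  move: le_i; move: #|_ : _| => i; rewrite /p; clear; nia.
have sXG : <[x]> \subset G by rewrite cycle_subG.
have [maxX | [P [sylP cycP nsPG]]] :=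
  cyclic_index_lt2p p_pr sXG (cycle_cyclic x) lt_i.
  exact: maximal_abelian_der2_central maxX (cycle_abelian x).
have [sPG nPG] := andP nsPG.
have hallP := pHall_Hall sylP.
apply: (der2_central_quotient hallP cycP nsPG).
have coPG : coprime #|P| #|G / P|.
  by rewrite card_quotient //; have /andP[] := hallP.
apply: IHk => [q q_pr q_dv|].
  have neq_qp : q <> p.
    move=> eq_qp; move: q_dv; rewrite eq_qp card_quotient // => p_dvi.
    by have /and3P[_ _] := sylP; rewrite p'natE // p_dvi.
  have := le_qp q q_pr (dvdn_trans q_dv (dvdn_quotient _ _)).
  by move: neq_qp; rewrite /p doubleS; clear; lia.
have oP : #|P| = (p ^ (logn p #|G|).-1.+1)%N.
  rewrite prednK ?logn_gt0 ?mem_primes ?p_pr ?cardG_gt0 //.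
  by rewrite (card_Hall sylP) p_part.
have le_quo := psi_cyclic_Sylow_quotient p_pr oP cycP nsPG coPG.
have oG : #|G| = (#|P| * #|G / P|)%N by rewrite card_quotient ?Lagrange.
move: le_psi; rewrite oG totient_coprime // [in totient #|P|]oP totient_pfactor //.
rewrite oP expnS -pred_Sn; set Q := (p ^ _)%N; set m := #|G / P|; set t := totient m.
have Q_gt0 : (0 < Q * Q)%N by rewrite muln_gt0 expn_gt0.
move=> le_psi; have {}le_psi : (3 * (8 * k.+1 + 5) * (p * p.-1) * (m * t)
    <= 5 * (8 * k.+1 + 7) * (p * p.-1).+1 * psi (G / P))%N.
  rewrite -(leq_pmul2l Q_gt0).
  have := leq_mul (leqnn (5 * (8 * k.+1 + 7))) le_quo; rewrite -/Q => le_quo'.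
  clear -le_psi le_quo'; move: le_psi le_quo'; move: p p.-1 Q m t.
  by clear; lia.
(* With [s = 4 * k ^ 2 + 10 * k], so that [p * (p - 1) = s + 6], the weights compare by [(16 * s +
   75) * (s + 7) <= (16 * s + 91) * (s + 6)], whose sides differ by 21. *)
by apply: leq_ratio_trans le_psi _; rewrite /p /= -!muln2; clear; lia.
Qed.

Theorem theorem10 (gT : finGroupType) (G : {group gT}) :
  3 * (#|G| * totient #|G|) <= 5 * psi G ->
  solvable G /\ (G^`(2) \subset 'Z(G))%g.
Proof.
(* Taking [k = #|G|] admits every prime divisor, and a weight above 1 only weakens the
   hypothesis. *)
move=> le_psi; apply: (@psi_bound_der2_central #|G|) => [q q_pr q_dv|].
  by apply: leq_trans (dvdn_leq (cardG_gt0 G) q_dv) _; rewrite -addnn; lia.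
by have := leq_mul (_ : 8 * #|G| + 5 <= 8 * #|G| + 7)%N le_psi; rewrite !mulnA; lia.
Qed.
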